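(* Let $G=(I,\lambda,V,(A_i)_{i\in I},J)$ be an anonymous game. If $J$ is monotone and $G$ satisfies the Unique Minimiser condition, then $G$ admits at most one Nash equilibrium (profiles being identified when they agree $\lambda$-almost everywhere).
   Context: For a measurable space $X$, $\mathcal P(X)$ denotes the set of probability measures on $X$. $I$ (the set of players) is a topological space with its Borel $\sigma$-field, $\lambda\in\mathcal P(I)$ is non-atomic, $V$ is a metric space with distance $d_V$ and its Borel $\sigma$-field, and $A_i\subset V$ is the action set of player $i\in I$. Admissible profiles: $\mathcal A=\{\Psi:I\to V \text{ measurable}: \Psi(i)\in A_i \text{ for } \lambda\text{-a.e. } i\in I\}$, two profiles being identified if they agree $\lambda$-a.e. $\Psi\sharp\lambda$ is the push-forward of $\lambda$ by $\Psi$. $\mathcal P_G(V)=\{\eta\in\mathcal P(V): \exists\,\Psi\in\mathcal A,\ \eta=\Psi\sharp\lambda\}$. Standing assumption: there exist $M_0>0$, $v_0\in V$ such that for $\lambda$-a.e. $i\in I$ and every $a\in A_i$, $d_V(v_0,a)<M_0$. Hence $\mathcal P_G(V)\subseteq\mathcal P_1(V)=\{\eta\in\mathcal P(V):\exists v\in V,\ \int_V d_V(v,a)\,d\eta(a)<+\infty\}$, endowed with the metric $d_1(\eta_1,\eta_2)=\sup\{\int_V f\,d(\eta_1-\eta_2): f:V\to\mathbb R \text{ 1-Lipschitz}\}$. $\mathrm{cov}$ denotes convex hull and the bar denotes closure in $(\mathcal P_1(V),d_1)$. The cost is a function $J:V\times\overline{\mathrm{cov}(\mathcal P_G(V))}\to\mathbb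 R$; the data $G=(I,\lambda,V,(A_i)_{i\in I},J)$ is called an anonymous game. $J$ is monotone if for all $\eta,\eta'\in\overline{\mathrm{cov}(\mathcal P_G(V))}$: $\int_V|J(a,\eta)|\,d\eta'(a)<+\infty$ and $\int_V\big(J(a,\eta)-J(a,\eta')\big)\,d(\eta-\eta')(a)\ge 0$. Unique Minimiser condition: for every $\eta\in\overline{\mathrm{cov}(\mathcal P_G(V))}$ there is $I_\eta\subseteq I$ with $\lambda(I\setminus I_\eta)=0$ such that for all $i\in I_\eta$ there is exactly one $a\in A_i$ minimizing $J(\cdot,\eta)$ over $A_i$. Nash equilibrium: a profile $\tilde\Psi\in\mathcal A$ such that $\tilde\Psi(i)\in\arg\min_{a\in A_i}J(a,\tilde\Psi\sharp\lambda)$ for $\lambda$-a.e. $i\in I$. *)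

(* Defs.v *)
From HB Require Import structures.
From mathcomp Require Import all_boot all_order all_algebra.
From mathcomp Require Import all_classical all_reals all_analysis.

Set Implicit Arguments.
Unset Strict Implicit.
Unset Printing Implicit Defensive.

Import Order.TTheory GRing.Theory Num.Theory.
Import numFieldNormedType.Exports.

Local Open Scope classical_set_scope.
Local Open Scope ring_scope.

(* Measurable types are pointed in the library, so the Borel sigma-algebra of a
   space is only available for pointed spaces. This is no restriction here: the
   spaces concerned carry a probability measure, hence are nonempty. *)
#[short(type="pmetricType")]
HB.structure Definition PointedMetric (K : numDomainType) :=
  {M of Metric K M & isPointed M}.

Notation borel T := (g_sigma_algebraType (@open T)).

Definition non_atomic d (T : measurableType d) (R : realType)
    (mu : probability T R) : Prop :=
  forall B : set T, measurable B -> (0 < mu B)%E ->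
    exists C : set T,
      [/\ measurable C, C `<=` B, (0 < mu C)%E & (mu C < mu B)%E].

(* The functions underlying elements of [probability T R] are defined on all
   sets, with unspecified values on the non-measurable ones; two of them are the
   same measure when they agree on measurable sets. *)
Definition same_measure d (T : measurableType d) (R : realType)
    (mu nu : probability T R) : Prop :=
  forall B : set T, measurable B -> mu B = nu B.

Definition cov d (T : measurableType d) (R : realType)
    (S : set (probability T R)) : set (probability T R) :=
  [set eta | exists (n : nat) (w : 'I_n -> R) (mu : 'I_n -> probability T R),
    [/\ forall k, 0 <= w k,
        \sum_(k < n) w k = 1,
        forall k, S (mu k)
      & forall B : set T, measurable B ->
          eta B = (\sum_(k < n) (w k)%:E * mu k B)%E]].

Definition argmin (T : Type) (R : realType) (X : set T) (f : T -> R) : set T :=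
  [set a | X a /\ forall b, X b -> f a <= f b].

Section Wasserstein.
Context {R : realType} {V : pmetricType R}.

Definition P1 : set (probability (borel V) R) :=
  [set eta : probability (borel V) R |
    exists v : V, (\int[eta]_a (mdist v a)%:E < +oo)%E].

Definition lipschitz1 : set (V -> R) :=
  [set f | forall x y : V, `|f x - f y| <= mdist x y].

Definition d1 (eta1 eta2 : probability (borel V) R) : \bar R :=
  ereal_sup
    [set (\int[eta1]_a f a - \int[eta2]_a f a)%:E | f in lipschitz1].

Definition d1_closure (S : set (probability (borel V) R)) :
    set (probability (borel V) R) :=
  [set eta | P1 eta /\ forall e : R, 0 < e ->
    exists eta', [/\ P1 eta', S eta' & (d1 eta eta' < e%:E)%E]].

End Wasserstein.

Section Game.
Context {R : realType} {I : ptopologicalType} {V : pmetricType R}.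
Variables (lambda : probability (borel I) R) (A : I -> set V).

Definition bounded_actions : Prop :=
  exists (M0 : R) (v0 : V), 0 < M0 /\
    {ae lambda, forall i, forall a, A i a -> mdist v0 a < M0}.

Definition admissible (Psi : {mfun borel I >-> borel V}) : Prop :=
  {ae lambda, forall i, A i (Psi i)}.

Definition PG : set (probability (borel V) R) :=
  [set eta | exists2 Psi : {mfun borel I >-> borel V},
     admissible Psi & same_measure eta (distribution lambda Psi)].

Definition cost_domain : set (probability (borel V) R) := d1_closure (cov PG).

(* A cost is a total function, of which only the values on [cost_domain] are
   ever used; the conditions below constrain nothing outside of it. *)
Variable J : V -> probability (borel V) R -> R.

(* [J] depends on the measure only, not on the values that represent it on
   non-measurable sets. *)
Definition cost_function : Prop :=
  forall (a : V) (eta eta' : probability (borel V) R),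
    cost_domain eta -> cost_domain eta' ->
    same_measure eta eta' -> J a eta = J a eta'.

Definition monotone_cost : Prop :=
  forall eta eta' : probability (borel V) R,
    cost_domain eta -> cost_domain eta' ->
    eta'.-integrable setT (fun a => (J a eta)%:E) /\
    0 <= \int[eta]_a (J a eta - J a eta') - \int[eta']_a (J a eta - J a eta').

Definition unique_minimiser : Prop :=
  forall eta : probability (borel V) R, cost_domain eta ->
    exists I_eta : set (borel I),
      [/\ measurable I_eta, lambda (~` I_eta) = 0%E
        & forall i, I_eta i -> exists! a, argmin (A i) (J ^~ eta) a].

Definition nash_equilibrium (Psi : {mfun borel I >-> borel V}) : Prop :=
  admissible Psi /\
  {ae lambda, forall i,
    argmin (A i) (J ^~ (distribution lambda Psi)) (Psi i)}.

End Game.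

(* Main.v *)
Require Import Defs.
From HB Require Import structures.
From mathcomp Require Import all_boot all_order all_algebra.
From mathcomp Require Import all_classical all_reals all_analysis measurable_realfun.
From mathcomp Require Import lra.

(** Let eta1 and eta2 be the laws of two equilibria Psi1 and Psi2 under lambda.
    Monotonicity at (eta1, eta2), transported from V to the set of players by
    change of variables, says that the sum of the regrets
      [J (Psi2 i) eta1 - J (Psi1 i) eta1] + [J (Psi1 i) eta2 - J (Psi2 i) eta2]
    has a nonpositive integral over the players. Each bracket is nonnegative for
    almost every player: Psi1 i is a best reply to eta1 and Psi2 i is feasible
    for i, and symmetrically. Hence both brackets vanish almost everywhere
    ([ae_ge0_Rintegral_le0]); the first one vanishing means that Psi2 i, too,
    minimises J(., eta1) over A_i, and uniqueness of the minimiser gives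
    Psi1 i = Psi2 i.

    The hypotheses on J speak only of measures in the closed convex hull of the
    laws of admissible profiles, so the laws eta1 and eta2 must be shown to lie
    in it ([cost_domain_distribution]). Only membership in P1 takes some work:
    it follows from the uniform bound on the actions and from the Borel
    measurability of the distance to a point. *)

Set Implicit Arguments.
Unset Strict Implicit.
Unset Printing Implicit Defensive.

Import Order.TTheory GRing.Theory Num.Theory.
Import numFieldNormedType.Exports.

Local Open Scope classical_set_scope.
Local Open Scope ring_scope.

Lemma open_mdist_lt (R : realType) (V : metricType R) (v : V) (r : R) :
  open [set a | mdist v a < r].
Proof.
rewrite openE => a /= var; rewrite /interior -nbhs_ballE.
exists (r - mdist v a) => /=; first by rewrite subr_gt0.
move=> b; rewrite ballEmdist /= => abr.
by rewrite (le_lt_trans (metric_triangle v a b))// addrC -ltrBrDr.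
Qed.

Lemma measurable_mdist (R : realType) (V : pmetricType R) (v : V) :
  measurable_fun [set: borel V] (mdist v : borel V -> R).
Proof.
apply: (measurability _ (RGenInftyO.measurableE R)).
move=> _ [_ [r ->] <-]; rewrite setTI; apply: sub_sigma_algebra.
rewrite (_ : _ @^-1` _ = [set a | mdist v a < r]); first exact: open_mdist_lt.
by apply/seteqP; split => a /=; rewrite in_itv.
Qed.

(** Half of the change of variables formula: monotonicity of a cost gives
    integrability with respect to the law, while regrets are integrated over the
    players. *)
Lemma integrable_distribution d d' (T : measurableType d)
    (T' : measurableType d') (R : realType) (P : probability T R)
    (X : {mfun T >-> T'}) (f : T' -> R) :
  (distribution P X).-integrable [set: T'] (EFin \o f) ->
  P.-integrable [set: T] (EFin \o (f \o X)).
Proof.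
move=> /integrableP[mf foo]; apply/integrableP; split.
  apply/measurable_EFinP; move/measurable_EFinP : mf => mf.
  exact: (measurableT_comp mf (measurable_funP X)).
rewrite (le_lt_trans _ foo)// ge0_integral_distribution//.
exact: measurableT_comp.
Qed.

Lemma Rintegral_distribution d d' (T : measurableType d)
    (T' : measurableType d') (R : realType) (P : probability T R)
    (X : {mfun T >-> T'}) (f : T' -> R) :
  (distribution P X).-integrable [set: T'] (EFin \o f) ->
  \int[distribution P X]_y f y = \int[P]_x f (X x).
Proof.
move=> intf; rewrite /Rintegral; congr fine.
have /integrableP[mf _] := intf.
exact: (integral_distribution (X := X) mf (integrable_distribution intf)).
Qed.

(** Almost everywhere g agrees with its absolute value, whose integral is
    therefore zero. *)
Lemma ae_ge0_Rintegral_le0 d (T : measurableType d) (R : realType)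
    (mu : measure T R) (g : T -> R) :
  mu.-integrable [set: T] (EFin \o g) ->
  {ae mu, forall x, 0 <= g x} ->
  \int[mu]_x g x <= 0 ->
  {ae mu, forall x, g x = 0}.
Proof.
move=> ig g0 Ig.
have /integrableP[mg _] := ig.
have mabs : measurable_fun setT (fun x => `|(g x)%:E|%E).
  exact: measurableT_comp.
have abs_int : (\int[mu]_x `|(g x)%:E| = \int[mu]_x (g x)%:E)%E.
  apply: ae_eq_integral => //; apply: filterS g0 => x g0 _.
  by rewrite /= ger0_norm.
have int0 : (\int[mu]_x `|(g x)%:E| = 0)%E.
  apply/eqP; rewrite eq_le integral_ge0// andbT abs_int.
  rewrite -[X in (X <= _)%E]fineK ?lee_fin//.
  exact: integrable_fin_num.
have /(ae_eq_integral_abs mu measurableT mg) : 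
  (\int[mu]_x `|(EFin \o g) x| = 0)%E by [].
by apply: filterS => x /(_ I) [].
Qed.

Lemma integral_ae_bounded_lty d (T : measurableType d) (R : realType)
    (P : probability T R) (g : T -> R) (M : R) :
  measurable_fun [set: T] g -> (forall x, 0 <= g x) ->
  {ae P, forall x, g x <= M} ->
  (\int[P]_x (g x)%:E < +oo)%E.
Proof.
move=> mg g0 gM.
have -> : (\int[P]_x (g x)%:E = \int[P]_x `|(g x)%:E|)%E.
  by apply: eq_integral => x _; rewrite /= ger0_norm.
apply: (@le_lt_trans _ _ ((Num.max 0 M)%:E * P setT)%E).
  apply: integral_le_bound => //; first exact/measurable_EFinP.
    by rewrite lee_fin le_max lexx.
  by apply: filterS gM => x gM _; rewrite lee_fin ger0_norm// le_max gM orbT.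
by rewrite probability_setT mule1 ltry.
Qed.

Section cost_domain.
Context (R : realType) (I : ptopologicalType) (V : pmetricType R).
Variables (lambda : probability (borel I) R) (A : I -> set V).

Lemma P1_distribution (Psi : {mfun borel I >-> borel V}) :
  bounded_actions lambda A -> admissible lambda A Psi ->
  P1 (distribution lambda Psi).
Proof.
move=> [M0 [v0 [M0_gt0 A_lt]]] Psi_A; exists v0.
have mdist_v0 : measurable_fun [set: borel V] (EFin \o mdist v0).
  by apply/measurable_EFinP; exact: measurable_mdist.
rewrite ge0_integral_distribution//; last first.
  by move=> a; rewrite lee_fin mdist_ge0.
apply: (@integral_ae_bounded_lty _ _ _ _ (mdist v0 \o Psi) M0).
- exact: (measurableT_comp (measurable_mdist v0) (measurable_funP Psi)).
- by move=> i; exact: mdist_ge0.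
- have ae_lambda := ae_filter_ringOfSetsType lambda.
  by apply: filterS2 A_lt Psi_A => i Ai_lt Psi_Ai; rewrite ltW//; exact: Ai_lt.
Qed.

Lemma cov_PG_distribution (Psi : {mfun borel I >-> borel V}) :
  admissible lambda A Psi -> cov (PG lambda A) (distribution lambda Psi).
Proof.
move=> Psi_A; exists 1%N, (fun=> 1), (fun=> distribution lambda Psi); split.
- by [].
- by rewrite big_ord1.
- by move=> _; exists Psi.
- by move=> B mB; rewrite big_ord1 mul1e.
Qed.

Lemma d1xx (eta : probability (borel V) R) : (d1 eta eta <= 0)%E.
Proof. by apply: ge_ereal_sup => _ [f _ <-]; rewrite subrr. Qed.

(** The law of an admissible profile approximates itself: it is a one-term
    convex combination, at distance zero from itself. *)
Lemma cost_domain_distribution (Psi : {mfun borel I >-> borel V}) :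
  bounded_actions lambda A -> admissible lambda A Psi ->
  cost_domain lambda A (distribution lambda Psi).
Proof.
move=> A_bounded Psi_A; have P1Psi := P1_distribution A_bounded Psi_A.
split=> // e e_gt0; exists (distribution lambda Psi); split=> //.
- exact: cov_PG_distribution.
- by rewrite (le_lt_trans (d1xx _))// lte_fin.
Qed.

End cost_domain.

Theorem theorem2p2 (R : realType) (I : ptopologicalType) (V : pmetricType R)
    (lambda : probability (borel I) R) (A : I -> set V)
    (J : V -> probability (borel V) R -> R)
    (lambda_non_atomic : non_atomic lambda)
    (A_bounded : bounded_actions lambda A)
    (J_cost : cost_function lambda A J)
    (J_monotone : monotone_cost lambda A J)
    (G_unique_minimiser : unique_minimiser lambda A J)
    (Psi1 Psi2 : {mfun borel I >-> borel V})
    (Psi1_nash : nash_equilibrium lambda A J Psi1)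
    (Psi2_nash : nash_equilibrium lambda A J Psi2) :
  {ae lambda, forall i, Psi1 i = Psi2 i}.
Proof.
have ae_lambda := ae_filter_ringOfSetsType lambda.
have [adm1 min1] := Psi1_nash; have [adm2 min2] := Psi2_nash.
have dom1 := cost_domain_distribution A_bounded adm1.
have dom2 := cost_domain_distribution A_bounded adm2.
set eta1 := distribution lambda Psi1 in min1 dom1 *.
set eta2 := distribution lambda Psi2 in min2 dom2 *.
have [int11 _] := J_monotone _ _ dom1 dom1.
have [int12 mon] := J_monotone _ _ dom1 dom2.
have [int21 _] := J_monotone _ _ dom2 dom1.
have [int22 _] := J_monotone _ _ dom2 dom2.
(* The regret of player i for playing the other equilibrium's action. *)
pose g1 i := J (Psi2 i) eta1 - J (Psi1 i) eta1.
pose g2 i := J (Psi1 i) eta2 - J (Psi2 i) eta2.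
have h11 := integrable_distribution int11.
have h12 := integrable_distribution int12.
have h21 := integrable_distribution int21.
have h22 := integrable_distribution int22.
have ig1 : lambda.-integrable setT (EFin \o g1).
  exact: (integrableB measurableT h12 h11).
have ig2 : lambda.-integrable setT (EFin \o g2).
  exact: (integrableB measurableT h21 h22).
have g1_ge0 : {ae lambda, forall i, 0 <= g1 i}.
  by apply: filterS2 min1 adm2 => i [_ min1] A2; rewrite subr_ge0 min1.
have g2_ge0 : {ae lambda, forall i, 0 <= g2 i}.
  by apply: filterS2 min2 adm1 => i [_ min2] A1; rewrite subr_ge0 min2.
have sum_le0 : \int[lambda]_i (g1 i + g2 i) <= 0.
  (* All four integrals of J(., eta_k) against eta_l are finite, so that both
     sides split into the same four terms. *)
  rewrite (RintegralD measurableT ig1 ig2).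
  rewrite (RintegralB measurableT h12 h11) (RintegralB measurableT h21 h22).
  move: mon.
  rewrite (RintegralB measurableT int11 int21).
  rewrite (RintegralB measurableT int12 int22).
  rewrite !Rintegral_distribution//=.
  by lra.
have sum0 : {ae lambda, forall i, g1 i + g2 i = 0}.
  apply: ae_ge0_Rintegral_le0 sum_le0; first exact: (integrableD measurableT ig1 ig2).
  by apply: filterS2 g1_ge0 g2_ge0 => i; exact: addr_ge0.
have g1_eq0 : {ae lambda, forall i, g1 i = 0}.
  by apply: filterS3 g1_ge0 g2_ge0 sum0 => i; lra.
have [I1 [mI1 I1_full uniq1]] := G_unique_minimiser _ dom1.
have I1_ae : {ae lambda, forall i, I1 i}.
  by exists (~` I1); split => //; exact: measurableC.
have min_eq : {ae lambda, forall i, argmin (A i) (J ^~ eta1) (Psi2 i)}.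
  apply: filterS3 min1 adm2 g1_eq0 => i [_ min1] A2 /eqP.
  by rewrite subr_eq0 => /eqP J12; split => // b Ab; rewrite J12 min1.
apply: filterS3 I1_ae min1 min_eq => i /uniq1[a [_ a_uniq]] m1 m2.
by rewrite -(a_uniq _ m1) -(a_uniq _ m2).
Qed.
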